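(* Consider the semi-discrete finite volume scheme $$\frac{d}{dt}\mathbf U_{i,j}=-\frac{\mathcal F_{i+\frac12,j}-\mathcal F_{i-\frac12,j}}{\Delta x}-\frac{\mathcal G_{i,j+\frac12}-\mathcal G_{i,j-\frac12}}{\Delta y}+\mathbf S_{i,j}$$ for the stochastic Galerkin shallow water system with time-independent bottom, with the energy conservative fluxes $\mathcal F=\mathcal F^{EC}$, $\mathcal G=\mathcal G^{EC}$ and source $\mathbf S_{i,j}$ defined in the context. Then this scheme is well-balanced, energy conservative, and has local truncation error $\mathcal O(\Delta x^2+\Delta y^2)$.
   Context: Let $\mathcal M_k\in\mathbb R^{K\times K}$, $(\mathcal M_k)_{l,m}=\int\phi_k\phi_l\phi_m\rho$, where $\phi_1\equiv1,\dots,\phi_K$ are polynomials orthonormal with respect to a probability density $\rho$ on $\mathbb R^d$ with all moments finite; $\mathcal P(\widehat z)=\sum_k\widehat z_k\mathcal M_k$ for $\widehat z\in\mathbb R^K$; $g>0$. The SG shallow water system is $\widehat U_t+\widehat F(\widehat U)_x+\widehat G(\widehat U)_y=\widehat S(\widehat U)$, $\widehat U=(\widehat h,\widehat{q^x},\widehat{q^y})\in\mathbb R^{3K}$, with $\widehat F=\big(\widehat{q^x};\ \mathcal P(\widehat{q^x})\mathcal P^{-1}(\widehat h)\widehat{q^x}+\tfrac12 g\mathcal P(\widehat h)\widehat h;\ \mathcal P(\widehat{q^x})\mathcal P^{-1}(\widehat h)\widehat{q^y}\big)$, $\widehat G=\big(\widehat{q^y};\ \mathcal P(\widehat{q^y})\mathcal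 P^{-1}(\widehat h)\widehat{q^x};\ \mathcal P(\widehat{q^y})\mathcal P^{-1}(\widehat h)\widehat{q^y}+\tfrac12 g\mathcal P(\widehat h)\widehat h\big)$, $\widehat S=\big(0;-g\mathcal P(\widehat h)\widehat B_x;-g\mathcal P(\widehat h)\widehat B_y\big)$, bottom $\widehat B(x,y)\in\mathbb R^K$ time independent. Discretization: uniform rectangular cells with sizes $\Delta x,\Delta y$, centers $(x_i,y_j)$; $\mathbf U_{i,j}(t)=(\mathbf h_{i,j},\mathbf q^x_{i,j},\mathbf q^y_{i,j})$ approximates the cell average of $\widehat U$, $\mathbf B_{i,j}$ that of $\widehat B$; $\mathcal P(\mathbf h_{i,j})$ is assumed positive definite; $\mathbf u_{i,j}=\mathcal P^{-1}(\mathbf h_{i,j})\mathbf q^x_{i,j}$, $\mathbf v_{i,j}=\mathcal P^{-1}(\mathbf h_{i,j})\mathbf q^y_{i,j}$. For any cell quantity $\mathbf a$: $\overline{\mathbf a}_{i+\frac12,j}=\tfrac12(\mathbf a_{i,j}+\mathbf a_{i+1,j})$, $[\![\mathbf a]\!]_{i+\frac12,j}=\mathbf a_{i+1,j}-\mathbf a_{i,j}$, and analogously $\overline{\mathbf a}_{i,j+\frac12}$, $[\![\mathbf a]\!]_{i,j+\frac12}$ in $j$; $\overline{\mathcal P(\mathbf h)\mathbf h}$ denotes the average of $\mathcal P(\mathbf h_{i,j})\mathbf h_{i,j}$. EC fluxes and source (all averages at the indicated interface): $\mathcal F^{EC}_{i+\frac12,j}=\big(\mathcal P(\overline{\mathbf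 h})\overline{\mathbf u};\ \tfrac12 g\,\overline{\mathcal P(\mathbf h)\mathbf h}+\mathcal P(\overline{\mathbf u})\mathcal P(\overline{\mathbf h})\overline{\mathbf u};\ \mathcal P(\overline{\mathbf v})\mathcal P(\overline{\mathbf h})\overline{\mathbf u}\big)_{i+\frac12,j}$, $\mathcal G^{EC}_{i,j+\frac12}=\big(\mathcal P(\overline{\mathbf h})\overline{\mathbf v};\ \mathcal P(\overline{\mathbf u})\mathcal P(\overline{\mathbf h})\overline{\mathbf v};\ \tfrac12 g\,\overline{\mathcal P(\mathbf h)\mathbf h}+\mathcal P(\overline{\mathbf v})\mathcal P(\overline{\mathbf h})\overline{\mathbf v}\big)_{i,j+\frac12}$, $\mathbf S_{i,j}=\Big(0;\ -\tfrac{g}{2\Delta x}\big(\mathcal P(\overline{\mathbf h}_{i+\frac12,j})[\![\mathbf B]\!]_{i+\frac12,j}+\mathcal P(\overline{\mathbf h}_{i-\frac12,j})[\![\mathbf B]\!]_{i-\frac12,j}\big);\ -\tfrac{g}{2\Delta y}\big(\mathcal P(\overline{\mathbf h}_{i,j+\frac12})[\![\mathbf B]\!]_{i,j+\frac12}+\mathcal P(\overline{\mathbf h}_{i,j-\frac12})[\![\mathbf B]\!]_{i,j-\frac12}\big)\Big)$. Discrete energy: $\mathbf E_{i,j}=\tfrac12\big((\mathbf q^x_{i,j})^\top\mathbf u_{i,j}+(\mathbf q^y_{i,j})^\top\mathbf v_{i,j}\big)+\tfrac12 g\|\mathbf h_{i,j}\|^2+g\mathbf h_{i,j}^\top\mathbf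 B_{i,j}$. Well-balanced: whenever $\mathbf q^x_{i,j}=\mathbf q^y_{i,j}=0$ and $\mathbf h_{i,j}+\mathbf B_{i,j}=\mathbf C$ (the same vector) for all $i,j$, the scheme gives $\frac{d}{dt}\mathbf U_{i,j}=0$ for all $i,j$. Energy conservative: there exist interface quantities $\mathcal H_{i+\frac12,j},\mathcal K_{i,j+\frac12}$ (numerical energy fluxes) such that along the scheme $\frac{d}{dt}\mathbf E_{i,j}=-\frac{\mathcal H_{i+\frac12,j}-\mathcal H_{i-\frac12,j}}{\Delta x}-\frac{\mathcal K_{i,j+\frac12}-\mathcal K_{i,j-\frac12}}{\Delta y}$ for all $i,j$. Local truncation error $\mathcal O(\Delta x^p+\Delta y^p)$: for smooth $\widehat U,\widehat B$ (with $\mathcal P(\widehat h)$ positive definite) inserted as cell values, the right-hand side of the scheme equals $\big(-\widehat F(\widehat U)_x-\widehat G(\widehat U)_y+\widehat S(\widehat U)\big)(x_i,y_j)+\mathcal O(\Delta x^p+\Delta y^p)$. *)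

(* Defs.v *)
From HB Require Import structures.
From mathcomp Require Import all_boot all_order all_algebra.
From mathcomp Require Import all_classical all_reals all_analysis.
Set Implicit Arguments. Unset Strict Implicit. Unset Printing Implicit Defensive.
Import Order.TTheory GRing.Theory Num.Theory.
Import numFieldNormedType.Exports.
Local Open Scope ring_scope.

(* The generalized polynomial chaos basis phi_1 = 1, ..., phi_K, orthonormal
   w.r.t. the probability measure mu (the paper: rho(xi) dxi on R^d).
   Index type 'I_K.+1 (so K.+1 basis functions), phi ord0 = phi_1. *)
Definition sg_basis (R : realType) (d : measure_display) (T : measurableType d)
  (mu : probability T R) (K : nat) (phi : 'I_K.+1 -> T -> R) : Prop :=
  [/\ (forall k, measurable_fun setT (phi k)),
      (forall x, phi ord0 x = 1),
      (forall l m, mu.-integrable setT (fun x => (phi l x * phi m x)%:E) /\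
                   \int[mu]_(x in setT) (phi l x * phi m x) = (l == m)%:R) &
      (forall k l m,
         mu.-integrable setT (fun x => (phi k x * phi l x * phi m x)%:E))].

Definition Mtrip (R : realType) (d : measure_display) (T : measurableType d)
  (mu : probability T R) (K : nat) (phi : 'I_K.+1 -> T -> R) (k : 'I_K.+1)
  : 'M[R]_K.+1 :=
  \matrix_(l, m) \int[mu]_(x in setT) (phi k x * phi l x * phi m x).

Section Scheme.
Variables (R : realType) (K : nat) (M : 'I_K.+1 -> 'M[R]_K.+1) (g : R).

Local Notation vec := 'cV[R]_K.+1.

Definition Pm (z : vec) : 'M[R]_K.+1 := \sum_(k < K.+1) z k 0 *: M k.

Definition posdef (A : 'M[R]_K.+1) : Prop :=
  forall x : vec, x != 0 -> 0 < (x^T *m A *m x) 0 0.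

Record st := St { hh : vec; qqx : vec; qqy : vec }.

Definition stc (U : st) (c : 'I_3) (k : 'I_K.+1) : R :=
  if val c == 0%N then hh U k 0 else if val c == 1%N then qqx U k 0
  else qqy U k 0.

Definition uof (U : st) : vec := invmx (Pm (hh U)) *m qqx U.
Definition vof (U : st) : vec := invmx (Pm (hh U)) *m qqy U.

Definition avg (a b : vec) : vec := 2^-1 *: (a + b).

Definition FEC (UL UR : st) : st :=
  let hb := avg (hh UL) (hh UR) in
  let ub := avg (uof UL) (uof UR) in
  let vb := avg (vof UL) (vof UR) in
  let phh := avg (Pm (hh UL) *m hh UL) (Pm (hh UR) *m hh UR) in
  St (Pm hb *m ub)
     ((g / 2) *: phh + Pm ub *m (Pm hb *m ub))
     (Pm vb *m (Pm hb *m ub)).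

Definition GEC (UL UR : st) : st :=
  let hb := avg (hh UL) (hh UR) in
  let ub := avg (uof UL) (uof UR) in
  let vb := avg (vof UL) (vof UR) in
  let phh := avg (Pm (hh UL) *m hh UL) (Pm (hh UR) *m hh UR) in
  St (Pm hb *m vb)
     (Pm ub *m (Pm hb *m vb))
     ((g / 2) *: phh + Pm vb *m (Pm hb *m vb)).

Definition rhs (dx dy : R) (U : int -> int -> st) (B : int -> int -> vec)
  (i j : int) : st :=
  let Fp := FEC (U i j) (U (i + 1)%R j) in
  let Fm := FEC (U (i - 1)%R j) (U i j) in
  let Gp := GEC (U i j) (U i (j + 1)%R) in
  let Gm := GEC (U i (j - 1)%R) (U i j) in
  let h := fun a b => hh (U a b) in
  let Sx := - (g / (2 * dx)) *:
      (Pm (avg (h i j) (h (i + 1)%R j)) *m (B (i + 1)%R j - B i j)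
       + Pm (avg (h (i - 1)%R j) (h i j)) *m (B i j - B (i - 1)%R j)) in
  let Sy := - (g / (2 * dy)) *:
      (Pm (avg (h i j) (h i (j + 1)%R)) *m (B i (j + 1)%R - B i j)
       + Pm (avg (h i (j - 1)%R) (h i j)) *m (B i j - B i (j - 1)%R)) in
  St (- dx^-1 *: (hh Fp - hh Fm) - dy^-1 *: (hh Gp - hh Gm))
     (- dx^-1 *: (qqx Fp - qqx Fm) - dy^-1 *: (qqx Gp - qqx Gm) + Sx)
     (- dx^-1 *: (qqy Fp - qqy Fm) - dy^-1 *: (qqy Gp - qqy Gm) + Sy).

Definition energy (U : st) (B : vec) : R :=
  2^-1 * ((qqx U)^T *m uof U + (qqy U)^T *m vof U) 0 0
  + g / 2 * ((hh U)^T *m hh U) 0 0 + g * ((hh U)^T *m B) 0 0.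

Definition Fhat (U : st) : st :=
  let iP := invmx (Pm (hh U)) in
  St (qqx U)
     (Pm (qqx U) *m (iP *m qqx U) + (g / 2) *: (Pm (hh U) *m hh U))
     (Pm (qqx U) *m (iP *m qqy U)).

Definition Ghat (U : st) : st :=
  let iP := invmx (Pm (hh U)) in
  St (qqy U)
     (Pm (qqy U) *m (iP *m qqx U))
     (Pm (qqy U) *m (iP *m qqy U) + (g / 2) *: (Pm (hh U) *m hh U)).

Definition Shat (U : st) (Bx By : vec) : st :=
  St 0 (- g *: (Pm (hh U) *m Bx)) (- g *: (Pm (hh U) *m By)).

End Scheme.

Definition dir2 (R : realType) (b : bool) : (R * R)%type :=
  if b then (1, 0) else (0, 1).

Fixpoint iterpd (R : realType) (ds : seq bool) (f : (R * R)%type -> R)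
  : (R * R)%type -> R :=
  match ds with
  | [::] => f
  | b :: ds' => iterpd ds' (fun p => 'D_(dir2 R b) f p)
  end.

Definition smooth2 (R : realType) (f : (R * R)%type -> R) : Prop :=
  forall ds : seq bool, continuous (iterpd ds f) /\
    forall (b : bool) (p : (R * R)%type), derivable (iterpd ds f) p (dir2 R b).

(* Main.v *)
(* The triple products make [(a, b) |-> P(a) b] symmetric and each [P(a)]
   symmetric. Hence P(avg a)[a] = [P(a) a] / 2, where [.] is the jump across an
   interface. This cancels pressure against bottom source for the lake at rest,
   and it makes the energy gradient V = (g(h + B) - (P(u)u + P(v)v)/2; u; v)
   satisfy, in the x direction,
     [V].F = (g/2) [(P(h)h).u] + g [B].P(avg h)(avg u),
   whose bottom term is matched by the source term; thus V.(F_+ - F_-) - dx V.S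
   telescopes. The y direction is the x direction with the two discharges
   exchanged.
   For consistency, F is symmetric in its two arguments and so is the source up
   to sign, so along a grid line the x part of the right-hand side is
   -(psi(dx) - psi(-dx))/dx with psi(s) = F(U(0), U(s)) + (source); this is a
   central difference, and psi'(0) is half the derivative of F(U(s), U(s)) plus
   the source contribution. *)
Require Import Defs.
From HB Require Import structures.
From mathcomp Require Import all_boot all_order all_algebra.
From mathcomp Require Import all_classical all_reals all_analysis.
From mathcomp Require Import ring lra.
Import Order.TTheory GRing.Theory Num.Theory.
Import numFieldNormedType.Exports.
Local Open Scope ring_scope.

Set Implicit Arguments.
Unset Strict Implicit.

(** * Symmetry and adjointness of the triple-product form *)

Section TrilinearForm.
Variables (R : realType) (K : nat) (M : 'I_K.+1 -> 'M[R]_K.+1).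
Local Notation vec := 'cV[R]_K.+1.
Implicit Types a b c x : vec.

(** These two transpositions generate all permutations of the three indices. *)
Definition sym_tensor :=
  (forall k l m, M k l m = M l k m) /\ (forall k l m, M k l m = M k m l).

Definition dot a b : R := (a^T *m b) 0 0.

Lemma PmE a b k :
  (Pm M a *m b) k 0 = \sum_j \sum_i a i 0 * M i k j * b j 0.
Proof.
rewrite mxE; apply: eq_bigr => j _; rewrite /Pm summxE mulr_suml.
by apply: eq_bigr => i _; rewrite mxE.
Qed.

Lemma PmD a b : Pm M (a + b) = Pm M a + Pm M b.
Proof. by rewrite /Pm -big_split; apply: eq_bigr => k _; rewrite mxE scalerDl. Qed.

Lemma PmZ (s : R) a : Pm M (s *: a) = s *: Pm M a.
Proof.
rewrite /Pm scaler_sumr; apply: eq_bigr => k _.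
by apply/matrixP => i j; rewrite !mxE mulrA.
Qed.

Lemma avg_same a : avg a a = a.
Proof. by apply/matrixP => i j; rewrite !mxE; lra. Qed.

Lemma avgC a b : avg a b = avg b a.
Proof. by rewrite /avg addrC. Qed.

Lemma dotC a b : dot a b = dot b a.
Proof. by rewrite /dot -[a in RHS]trmxK -trmx_mul [RHS]mxE. Qed.

Lemma dotDl a b c : dot (a + b) c = dot a c + dot b c.
Proof. by rewrite /dot linearD mulmxDl mxE. Qed.

Lemma dotDr a b c : dot c (a + b) = dot c a + dot c b.
Proof. by rewrite /dot mulmxDr mxE. Qed.

Lemma dotZl (s : R) a c : dot (s *: a) c = s * dot a c.
Proof. by rewrite /dot linearZ -scalemxAl mxE. Qed.

Lemma dotZr (s : R) a c : dot c (s *: a) = s * dot c a.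
Proof. by rewrite /dot -scalemxAr mxE. Qed.

Lemma dotNl a c : dot (- a) c = - dot a c.
Proof. by rewrite -scaleN1r dotZl mulN1r. Qed.

Lemma dotNr a c : dot c (- a) = - dot c a.
Proof. by rewrite -scaleN1r dotZr mulN1r. Qed.

Lemma dotE a b : dot a b = \sum_i a i 0 * b i 0.
Proof. by rewrite /dot mxE; apply: eq_bigr => i _; rewrite mxE. Qed.

(** A nonzero row vector [v] with [v *m A = 0] would make the quadratic form vanish at [v^T]. *)
Lemma posdef_unitmx (A : 'M[R]_K.+1) : posdef A -> A \in unitmx.
Proof.
move=> pA; rewrite unitmxE unitfE; apply/det0P => -[v v0 vA].
have := pA v^T; rewrite trmxK vA mul0mx mxE ltxx => /(_ _)/notF; apply.
by apply: contraNneq v0 => /(congr1 trmx); rewrite trmxK trmx0 => ->.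
Qed.

Hypothesis symM : sym_tensor.

Lemma PmC a b : Pm M a *m b = Pm M b *m a.
Proof.
apply/matrixP => k j; rewrite (ord1 j) !PmE exchange_big /=.
apply: eq_bigr => i _; apply: eq_bigr => l _.
(* Exchanging the outer indices takes three adjacent swaps. *)
have -> : M i k l = M l k i by rewrite symM.1 symM.2 symM.1.
by rewrite mulrC mulrA [RHS]mulrAC.
Qed.

Lemma Pm_tr a : (Pm M a)^T = Pm M a.
Proof.
apply/matrixP => k l; rewrite mxE /Pm !summxE; apply: eq_bigr => i _.
by rewrite !mxE symM.2.
Qed.

Lemma dot_Pml a b c : dot (Pm M a *m b) c = dot b (Pm M a *m c).
Proof. by rewrite /dot trmx_mul Pm_tr mulmxA. Qed.

(** In the expanded product the cross terms [Pm M a *m b] and [Pm M b *m a] cancel by [PmC]. *)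
Lemma Pm_diff_avg a b :
  Pm M (avg a b) *m (b - a) = 2^-1 *: (Pm M b *m b - Pm M a *m a).
Proof.
rewrite /avg PmZ PmD -scalemxAl mulmxDl !mulmxBr (PmC a b); congr (_ *: _).
by rewrite addrC addrA subrK.
Qed.

End TrilinearForm.

(** * The numerical energy flux seen from both sides of an interface *)

Section DiscreteEnergy.
Variables (R : realType) (K : nat) (M : 'I_K.+1 -> 'M[R]_K.+1) (g : R).
Local Notation vec := 'cV[R]_K.+1.
Implicit Types (U : st R K) (B : vec).

(* Gradient of the energy with respect to the water height; the gradients with
   respect to the two discharges are the velocities. *)
Definition energy_grad_h U B : vec :=
  g *: (hh U + B)
  - 2^-1 *: (Pm M (uof M U) *m uof M U + Pm M (vof M U) *m vof M U).

Definition energy_rate U B (dU : st R K) : R :=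
  dot (energy_grad_h U B) (hh dU) + dot (uof M U) (qqx dU)
  + dot (vof M U) (qqy dU).

(* Discrete integration by parts leaves this left-sided form of the numerical
   energy flux; [efluxE] is the same flux read from the right cell. *)
Definition eflux UL BL UR BR : R :=
  energy_rate UL BL (FEC M g UL UR)
  + g / 2 * dot (uof M UL) (Pm M (avg (hh UL) (hh UR)) *m (BR - BL))
  - g / 2 * dot (Pm M (hh UL) *m hh UL) (uof M UL).

Hypothesis symM : sym_tensor M.

(** This is [Pm_diff_avg] paired with [w], after moving the self-adjoint [Pm M (avg a b)] across. It
    serves for the jumps of both velocities and of the height. *)
Lemma kinetic_jump a b (w : vec) :
  dot (Pm M b *m b) w - dot (Pm M a *m a) w = 2 * dot (b - a) (Pm M (avg a b) *m w).
Proof.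
rewrite -dot_Pml // Pm_diff_avg // dotZl dotDl dotNl mulrA divff ?mul1r //.
Qed.

Lemma efluxE UL BL UR BR :
  eflux UL BL UR BR =
  energy_rate UR BR (FEC M g UL UR)
  - g / 2 * dot (uof M UR) (Pm M (avg (hh UL) (hh UR)) *m (BR - BL))
  - g / 2 * dot (Pm M (hh UR) *m hh UR) (uof M UR).
Proof.
rewrite /eflux /energy_rate /energy_grad_h /FEC /=.
set uL := uof M UL; set uR := uof M UR; set vL := vof M UL; set vR := vof M UR.
(* [w] is the mass flux. [ju] and [jv] cancel the kinetic part of the height gradient against the
   momentum fluxes; [jh] handles the pressure and [wB] the bottom. *)
set hL := hh UL; set hR := hh UR; set w := Pm M (avg hL hR) *m avg uL uR.
have ju := kinetic_jump uL uR w; have jv := kinetic_jump vL vR w.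
have jh := kinetic_jump hL hR (avg uL uR); rewrite -/w in jh.
set x := Pm M (avg hL hR) *m (BR - BL).
have wB : dot (BR - BL) w = dot (avg uL uR) x by rewrite dotC dot_Pml.
have dot_avg a b c : dot (avg a b) c = 2^-1 * (dot a c + dot b c).
  by rewrite dotZl dotDl.
rewrite dotDl dotNl dot_avg in wB; rewrite dotDl dotNl in ju.
rewrite dotDl dotNl in jv.
rewrite dotDl dotNl 2![dot (Pm M _ *m _) (avg _ _)]dotC !dot_avg in jh.
rewrite !(dotDl, dotDr, dotNl, dotNr, dotZl, dotZr).
rewrite 2![dot (Pm M _ *m _) (uof M _)]dotC -/uL -/uR.
(* Both identities enter multiplied by [g]; this makes the goal a linear combination of the
   hypotheses. *)
have := congr1 ( *%R g) jh; have := congr1 ( *%R g) wB.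
lra.
Qed.

End DiscreteEnergy.

(** * Local energy balance and the lake at rest *)

Section SemiDiscreteScheme.
Variables (R : realType) (K : nat) (M : 'I_K.+1 -> 'M[R]_K.+1) (g : R).
Local Notation vec := 'cV[R]_K.+1.
Hypothesis symM : sym_tensor M.

Definition swapq (U : st R K) : st R K := St (hh U) (qqy U) (qqx U).

Lemma GEC_swap (UL UR : st R K) :
  GEC M g UL UR = swapq (FEC M g (swapq UL) (swapq UR)).
Proof. by []. Qed.

Lemma energy_rate_swap (U : st R K) (B : vec) (dU : st R K) :
  energy_rate M g U B (swapq dU) = energy_rate M g (swapq U) B dU.
Proof.
by rewrite /energy_rate /energy_grad_h /= [X in 2^-1 *: X]addrC addrAC.
Qed.

Definition eflux_y (UL : st R K) (BL : vec) (UR : st R K) (BR : vec) : R :=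
  eflux M g (swapq UL) BL (swapq UR) BR.

(** In each direction the pressure terms [dot (Pm M h *m h) u] of the cell cancel between its two
    interfaces, while the two bottom terms have opposite signs and add up to the source. *)
Lemma energy_rate_rhs (dx dy : R) (U : int -> int -> st R K)
    (B : int -> int -> vec) i j :
  energy_rate M g (U i j) (B i j) (rhs M g dx dy U B i j) =
    - (eflux M g (U i j) (B i j) (U (i + 1) j) (B (i + 1) j)
       - eflux M g (U (i - 1) j) (B (i - 1) j) (U i j) (B i j)) / dx
    - (eflux_y (U i j) (B i j) (U i (j + 1)) (B i (j + 1))
       - eflux_y (U i (j - 1)) (B i (j - 1)) (U i j) (B i j)) / dy.
Proof.
(* The left and lower interfaces are read from their right cell, so that every term involves the
   energy gradient at cell [(i, j)]. *)
rewrite /eflux_y [eflux M g (U (i - 1) j) _ _ _]efluxE //.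
rewrite [eflux M g (swapq (U i (j - 1))) _ _ _]efluxE //.
rewrite /eflux -!energy_rate_swap -!GEC_swap /rhs.
set Fp := FEC _ _ (U i j) _; set Fm := FEC _ _ _ (U i j).
set Gp := GEC _ _ (U i j) _; set Gm := GEC _ _ _ (U i j).
rewrite /energy_rate /= -!/(vof M _) !invfM.
rewrite -[uof M (swapq (U i j))]/(vof M (U i j)).
rewrite !(dotDr, dotNr, dotZr).
ring.
Qed.

Lemma rhs_lake_at_rest (dx dy : R) (U : int -> int -> st R K)
    (B : int -> int -> vec) :
  (forall i j, qqx (U i j) = 0 /\ qqy (U i j) = 0) ->
  (exists C, forall i j, hh (U i j) + B i j = C) ->
  forall i j, rhs M g dx dy U B i j = St 0 0 0.
Proof.
move=> q0 [C hB] i j.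
have u0 a b : uof M (U a b) = 0 by rewrite /uof (q0 a b).1 mulmx0.
have v0 a b : vof M (U a b) = 0 by rewrite /vof (q0 a b).2 mulmx0.
have BE a b : B a b = C - hh (U a b) by rewrite -(hB a b) addrAC subrr add0r.
(* The jump of [B] is minus that of the height, so the source becomes a difference of pressures, the
   only flux terms left at zero velocity. *)
have jumpB a b a' b' :
    Pm M (avg (hh (U a b)) (hh (U a' b'))) *m (B a' b' - B a b) =
    - (2^-1 *: (Pm M (hh (U a' b')) *m hh (U a' b')
                - Pm M (hh (U a b)) *m hh (U a b))).
  rewrite -Pm_diff_avg // -mulmxN; congr (_ *m _).
  by rewrite !BE !opprB addrC addrA subrK.
rewrite /rhs /FEC /GEC /= !jumpB !u0 !v0 !avg_same !mulmx0 !addr0.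
congr St; apply/matrixP => k l; rewrite !mxE ?invfM; lra.
Qed.

End SemiDiscreteScheme.

(** * Closure of function classes under matrix operations *)

Section FunctionAlgebra.
Variables (R : realType) (P : (R -> R) -> Prop).

(** Instantiated with differentiability at a point and with [Cn n], so that matrix expressions are
    treated once for both. *)
Definition fct_algebra :=
  [/\ forall c, P (fun=> c),
      forall f1 f2, P f1 -> P f2 -> P (fun s => f1 s + f2 s) &
      forall f1 f2, P f1 -> P f2 -> P (fun s => f1 s * f2 s)].

Hypothesis algP : fct_algebra.

Lemma fct_algebra_sum (I : Type) (r : seq I) (Q : pred I) (F : I -> R -> R) :
  (forall i, P (F i)) -> P (fun s => \sum_(i <- r | Q i) F i s).
Proof.
move=> PF; case: algP => Pc Pa _; elim: r => [|i r IH].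
  by under eq_fun do rewrite big_nil; exact: Pc.
under eq_fun do rewrite big_cons; case: (Q i) => //.
by apply: Pa.
Qed.

Lemma fct_algebra_prod (I : Type) (r : seq I) (Q : pred I) (F : I -> R -> R) :
  (forall i, P (F i)) -> P (fun s => \prod_(i <- r | Q i) F i s).
Proof.
move=> PF; case: algP => Pc _ Pm; elim: r => [|i r IH].
  by under eq_fun do rewrite big_nil; exact: Pc.
under eq_fun do rewrite big_cons; case: (Q i) => //.
by apply: Pm.
Qed.

Lemma fct_algebra_mulmx m n p (A : R -> 'M[R]_(m, n)) (B : R -> 'M[R]_(n, p)) :
  (forall i j, P (fun s => A s i j)) -> (forall i j, P (fun s => B s i j)) ->
  forall i j, P (fun s => (A s *m B s) i j).
Proof.
move=> PA PB i j; under eq_fun do rewrite mxE.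
by apply: fct_algebra_sum => k; case: algP => _ _; apply.
Qed.

Lemma fct_algebra_det n (A : R -> 'M[R]_n) :
  (forall i j, P (fun s => A s i j)) -> P (fun s => \det (A s)).
Proof.
move=> PA; rewrite /determinant; apply: fct_algebra_sum => /= s.
case: (algP) => Pc _ Pm; apply: Pm; first exact: Pc.
exact: fct_algebra_prod.
Qed.

Lemma fct_algebra_adj n (A : R -> 'M[R]_n) :
  (forall i j, P (fun s => A s i j)) ->
  forall i j, P (fun s => (\adj (A s)) i j).
Proof.
move=> PA i j; under eq_fun do rewrite mxE /cofactor.
case: (algP) => Pc _ Pm; apply: Pm; first exact: Pc.
apply: fct_algebra_det => k l; under eq_fun do rewrite !mxE.
exact: PA.
Qed.

(** The reciprocal determinant is the only non-polynomial ingredient of Cramer's rule, hence a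
    separate hypothesis. *)
Lemma fct_algebra_cramer n (A : R -> 'M[R]_n) (b : R -> 'cV[R]_n) :
  (forall i j, P (fun s => A s i j)) -> (forall i, P (fun s => b s i 0)) ->
  P (fun s => (\det (A s))^-1) ->
  forall i, P (fun s => ((\det (A s))^-1 *: \adj (A s) *m b s) i 0).
Proof.
move=> PA Pb Pd i; apply: fct_algebra_mulmx => [k l|k l]; last by rewrite ord1.
under eq_fun do rewrite mxE.
by case: (algP) => _ _ Pm; apply: Pm => //; exact: fct_algebra_adj.
Qed.

Lemma fct_algebra_Pm K (M : 'I_K.+1 -> 'M[R]_K.+1) (a : R -> 'cV[R]_K.+1) :
  (forall i, P (fun s => a s i 0)) ->
  forall i j, P (fun s => Pm M (a s) i j).
Proof.
move=> Pa i j; rewrite /Pm; under eq_fun do rewrite summxE.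
apply: fct_algebra_sum => k; under eq_fun do rewrite mxE.
by case: (algP) => Pc _ Pm; apply: Pm.
Qed.

End FunctionAlgebra.

(** * C^n functions of one variable and the central difference *)

Section RealDerivatives.
Variable R : realType.
Implicit Types (f : R -> R) (x : R).

Lemma is_derive_continuous f x (d : R) : is_derive x 1 f d -> {for x, continuous f}.
Proof. by move=> [df _]; apply/differentiable_continuous/derivable1_diffP. Qed.

Lemma is_derive_add f1 f2 x (d1 d2 : R) :
  is_derive x 1 f1 d1 -> is_derive x 1 f2 d2 ->
  is_derive x 1 (fun s => f1 s + f2 s) (d1 + d2).
Proof. exact: is_deriveD. Qed.

Lemma is_derive_mul f1 f2 x (d1 d2 : R) :
  is_derive x 1 f1 d1 -> is_derive x 1 f2 d2 ->
  is_derive x 1 (fun s => f1 s * f2 s) (d1 * f2 x + f1 x * d2).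
Proof.
move=> D1 D2; have := is_deriveM D1 D2.
by rewrite /GRing.scale /= addrC [f2 x * _]mulrC.
Qed.

Lemma is_derive_bigsum (I : Type) (r : seq I) (F : I -> R -> R) (dF : I -> R) x :
  (forall i, is_derive x 1 (F i) (dF i)) ->
  is_derive x 1 (fun s => \sum_(i <- r) F i s) (\sum_(i <- r) dF i).
Proof.
move=> DF; elim: r => [|i r IH].
  by rewrite big_nil; under eq_fun do rewrite big_nil; exact: is_derive_cst.
by rewrite big_cons; under eq_fun do rewrite big_cons; exact: is_derive_add.
Qed.

Lemma is_derive_inv f x (d : R) : f x != 0 -> is_derive x 1 f d ->
  is_derive x 1 (fun s => (f s)^-1) (- d * (f x)^-1 ^+ 2).
Proof.
move=> fx0 [df <-]; apply: DeriveDef; first exact: derivableV.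
by rewrite deriveV // /GRing.scale /= exprVn mulNr mulrC -mulNr.
Qed.

Lemma is_derive_eqfun f1 f2 x (d : R) : f1 =1 f2 -> is_derive x 1 f1 d ->
  is_derive x 1 f2 d.
Proof. by move=> /funext ->. Qed.

Lemma derivable_fct_algebra x : fct_algebra (fun f => derivable f x 1).
Proof.
split=> [c|f1 f2|f1 f2]; [exact: derivable_cst|exact: derivableD|].
exact: derivableM.
Qed.

(** The class C^n on the line, peeled from the first derivative so that closure properties follow by
    induction on [n]. *)
Fixpoint Cn n f : Prop :=
  if n is n.+1 then
    exists2 f' : R -> R, (forall x, is_derive x 1 f (f' x)) & Cn n f'
  else continuous f.

Lemma CnW n f : Cn n.+1 f -> Cn n f.
Proof.
elim: n f => [|n IH] f [f' Df Cf'].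
  by move=> x; exact: is_derive_continuous (Df x).
by exists f' => //; exact: IH.
Qed.

Lemma Cn_cst n (c : R) : Cn n (fun=> c).
Proof.
elim: n c => [|n IH] c; first by move=> x; exact: cvg_cst.
by exists (fun=> 0) => // x; exact: is_derive_cst.
Qed.

Lemma Cn_add n f1 f2 : Cn n f1 -> Cn n f2 -> Cn n (fun s => f1 s + f2 s).
Proof.
elim: n f1 f2 => [|n IH] f1 f2.
  by move=> c1 c2 x; apply: cvgD; [exact: c1|exact: c2].
move=> [f1' D1 C1] [f2' D2 C2]; exists (fun s => f1' s + f2' s).
  by move=> x; exact: is_derive_add.
exact: IH.
Qed.

Lemma Cn_mul n f1 f2 : Cn n f1 -> Cn n f2 -> Cn n (fun s => f1 s * f2 s).
Proof.
elim: n f1 f2 => [|n IH] f1 f2.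
  by move=> c1 c2 x; apply: cvgM; [exact: c1|exact: c2].
move=> C1 C2; have C1n := CnW C1; have C2n := CnW C2.
case: C1 C2 => [f1' D1 C1] [f2' D2 C2].
exists (fun s => f1' s * f2 s + f1 s * f2' s).
  by move=> x; exact: is_derive_mul.
by apply: Cn_add; exact: IH.
Qed.

Lemma Cn_fct_algebra n : fct_algebra (Cn n).
Proof. by split; [exact: Cn_cst|exact: Cn_add|exact: Cn_mul]. Qed.

(** By induction: the derivative [- f' / f^2] is a product of functions already known to be C^n. *)
Lemma Cn_inv n f : (forall x, f x != 0) -> Cn n f -> Cn n (fun s => (f s)^-1).
Proof.
move=> f0; elim: n => [|n IH]; first by move=> c x; apply: cvgV => //; exact: c.
move=> C; have /IH Cinv := CnW C; case: C => [f' D C].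
exists (fun s => (-1 * f' s) * ((f s)^-1 * (f s)^-1)); last first.
  by do !apply: Cn_mul => //; exact: Cn_cst.
by move=> x; have := is_derive_inv (f0 x) (D x); rewrite mulN1r expr2.
Qed.

(** The mean value theorem stands in for integration: the factor [1/(n+1)] is given up and one power
    of [s] is gained. *)
Lemma increment_bound f (f' : R -> R) (A delta : R) n :
  (forall x, is_derive x 1 f (f' x)) -> f 0 = 0 ->
  (forall s, 0 <= s < delta -> `|f' s| <= A * s ^+ n) ->
  forall s, 0 <= s < delta -> `|f s| <= A * s ^+ n.+1.
Proof.
move=> Df f0 bnd s /andP[s0 sd].
have cf : ({within `[0, s], continuous f})%classic.
  by apply: continuous_subspaceT => y; exact: is_derive_continuous (Df y).
have [x] := MVT_segment s0 (fun x _ => Df x) cf.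
rewrite in_itv /= f0 !subr0 => /andP[x0 xs] ->; rewrite normrM (ger0_norm s0).
have A0 : 0 <= A * x ^+ n.
  by apply: le_trans (bnd x _) => //; rewrite x0 (le_lt_trans xs).
have [->|sn0] := eqVneq s 0; first by rewrite mulr0 exprS mul0r mulr0.
have sp : 0 < s by rewrite lt_neqAle eq_sym sn0.
rewrite exprSr mulrA ler_wpM2r // (le_trans (bnd x _)) //.
  by rewrite x0 (le_lt_trans xs).
rewrite ler_wpM2l ?lerXn2r ?nnegrE //.
(* The sign of [A] is read off the bound itself, since [s ^+ n] is positive. *)
have := bnd s; rewrite s0 sd => /(_ isT) /(le_trans (normr_ge0 _)).
by rewrite pmulr_lge0 // exprn_gt0.
Qed.

Lemma is_derive_reflect f x (d : R) : is_derive (- x) 1 f d ->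
  is_derive x 1 (fun s => f (- s)) (- d).
Proof.
by move=> D; have := is_derive1_comp D (is_deriveNid x 1); rewrite mulrN1.
Qed.

(** The function [f s - f (- s) - 2 * f1 0 * s] and its first two derivatives vanish at 0, and its
    third derivative is bounded near 0. Three uses of [increment_bound] give a cubic bound, which is
    then divided by [s]. *)
Lemma central_difference f (d : R) : Cn 3 f -> is_derive (0 : R) 1 f d ->
  exists C delta : R, 0 < delta /\ forall s, 0 < s < delta ->
    `|(f s - f (- s)) / s - 2 * d| <= C * s ^+ 2.
Proof.
move=> [f1 D1 [f2 D2 [f3 D3 c3]]] D.
have dE : d = f1 0 by have [_ <-] := D; have [_ <-] := D1 0.
have [delta delta0 bnd] : exists2 delta, 0 < delta &
    forall s, `|s| < delta -> `|f3 s| <= `|f3 0| + 1.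
  have /cvgrPdist_lt /(_ 1 ltr01) := c3 0.
  move=> /nbhs_ballP[e e0 h]; exists e => // s se.
  have := h s; rewrite /ball /= sub0r normrN => /(_ se) h1.
  rewrite -[f3 s](subrK (f3 0)) addrC (le_trans (ler_normD _ _)) //.
  by rewrite lerD2l distrC ltW.
(* The third derivative is [f3 t + f3 (- t)], hence the constant [2 * L]. *)
set L := `|f3 0| + 1 in bnd *; exists (2 * L), delta; split=> // s /andP[s0 sd].
have e2 : forall t, 0 <= t < delta -> `|f2 t - f2 (- t)| <= 2 * L * t ^+ 1.
  apply: (@increment_bound _ (fun t => f3 t + f3 (- t))).
  - move=> x; have := is_derive_add (D3 x) (is_deriveN (is_derive_reflect (D3 (- x)))).
    by rewrite opprK.
  - by rewrite oppr0 subrr.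
  - move=> t /andP[t0 td]; rewrite expr0 mulr1 (le_trans (ler_normD _ _)) //.
    by rewrite mulr_natl mulr2n lerD ?bnd ?normrN ?ger0_norm.
have e1 : forall t, 0 <= t < delta -> `|f1 t + f1 (- t) - 2 * f1 0| <= 2 * L * t ^+ 2.
  apply: (@increment_bound _ (fun t => f2 t - f2 (- t))) => //.
  - move=> x; have := is_derive_add (is_derive_add (D2 x) (is_derive_reflect (D2 (- x))))
      (is_derive_cst (- (2 * f1 0)) x 1).
    by rewrite addr0.
  - by rewrite oppr0; ring.
have e0 : `|f s - f (- s) - 2 * f1 0 * s| <= 2 * L * s ^+ 3.
  apply: (@increment_bound (fun s => f s - f (- s) - 2 * f1 0 * s)
    (fun t => f1 t + f1 (- t) - 2 * f1 0) _ _ _ _ _ e1).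
  - move=> x; have := is_derive_add (is_derive_add (D1 x)
      (is_deriveN (is_derive_reflect (D1 (- x)))))
      (is_deriveN (is_derive_mul (is_derive_cst (2 * f1 0) x 1) (is_derive_id x 1))).
    by rewrite opprK mul0r add0r mulr1.
  - by rewrite oppr0; ring.
  - by rewrite (ltW s0).
have -> : (f s - f (- s)) / s - 2 * d = (f s - f (- s) - 2 * f1 0 * s) / s.
  by rewrite dE [RHS]mulrBl mulfK // gt_eqF.
rewrite normrM normfV (gtr0_norm s0) ler_pdivrMr //.
by rewrite -[leRHS]mulrA -exprSr.
Qed.

End RealDerivatives.

(** * Time derivative of the discrete energy *)

Section EnergyDerivative.
Variables (R : realType) (K : nat) (M : 'I_K.+1 -> 'M[R]_K.+1) (g : R).
Local Notation vec := 'cV[R]_K.+1.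
Implicit Types (a b h q : R -> vec) (t : R).

Definition is_vderive t a (da : vec) : Prop :=
  forall k, is_derive t 1 (fun s => a s k 0) (da k 0).

Lemma is_derive_dot t a b da db :
  is_vderive t a da -> is_vderive t b db ->
  is_derive t 1 (fun s => dot (a s) (b s)) (dot da (b t) + dot (a t) db).
Proof.
move=> Da Db; rewrite !dotE -big_split /=; under eq_fun do rewrite dotE.
by apply: is_derive_bigsum => i; exact: is_derive_mul.
Qed.

Lemma is_vderive_Pm t a b da db :
  is_vderive t a da -> is_vderive t b db ->
  is_vderive t (fun s => Pm M (a s) *m b s)
    (Pm M da *m b t + Pm M (a t) *m db).
Proof.
move=> Da Db k; rewrite mxE !PmE -big_split /=; under eq_fun do rewrite PmE.
apply: is_derive_bigsum => j; rewrite -big_split /=.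
apply: is_derive_bigsum => i; apply: is_derive_mul => //.
have := is_derive_mul (Da i) (is_derive_cst (M i k j) t 1).
by rewrite mulr0 addr0.
Qed.

Lemma invmxE n (A : 'M[R]_n) : \det A != 0 -> invmx A = (\det A)^-1 *: \adj A.
Proof. by move=> dA; rewrite /invmx unitmxE unitfE dA. Qed.

Hypothesis symM : sym_tensor M.

Section Velocity.
Variables (t : R) (h q : R -> vec) (dh dq : vec).
Hypotheses (Dh : is_vderive t h dh) (Dq : is_vderive t q dq).
Hypothesis unit_h : Pm M (h t) \in unitmx.

Let w s := invmx (Pm M (h s)) *m q s.

Let derivable_Pm i j : derivable (fun s => Pm M (h s) i j) t 1.
Proof.
by apply: (fct_algebra_Pm (derivable_fct_algebra t)) => k; case: (Dh k).
Qed.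

(** [invmx] returns a default value on singular matrices, so formulas for the velocity are valid
    only where the determinant is nonzero. Invertibility at [t] spreads to nearby times by
    continuity. *)
Lemma near_det_neq0 : \forall s \near t, \det (Pm M (h s)) != 0.
Proof.
have dd := fct_algebra_det (derivable_fct_algebra t) derivable_Pm.
have ct := is_derive_continuous (derivableP dd).
have d0 : \det (Pm M (h t)) != 0 by rewrite -unitfE -unitmxE.
by move: ct => /(_ _ (open_nbhs_nbhs (conj (@open_neq _ 0) d0))).
Qed.

(* Differentiability comes from Cramer's rule near [t]; the value of the
   derivative then follows by differentiating [Pm M (h s) *m w s = q s]. *)
Lemma velocity_is_vderive :
  exists2 dw, is_vderive t w dw & Pm M dh *m w t + Pm M (h t) *m dw = dq.
Proof.
have dd := fct_algebra_det (derivable_fct_algebra t) derivable_Pm.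
have dw k : derivable (fun s => w s k 0) t 1.
  have d0 : \det (Pm M (h t)) != 0 by rewrite -unitfE -unitmxE.
  apply: (near_eq_derivable (f := fun s =>
    ((\det (Pm M (h s)))^-1 *: \adj (Pm M (h s)) *m q s) k 0)).
    by near=> s; rewrite /w invmxE //; near: s; exact: near_det_neq0.
  apply: (fct_algebra_cramer (derivable_fct_algebra t)) => // [i|].
    by case: (Dq i).
  exact: derivableV.
exists (\col_k 'D_1 (fun s => w s k 0) t).
  by move=> k; rewrite mxE; exact: derivableP.
set dw' := \col_k _; have Dw : is_vderive t w dw'.
  by move=> k; rewrite mxE; exact: derivableP.
apply/matrixP => k j; rewrite (ord1 j).
have [_ <-] := is_vderive_Pm Dh Dw k; have [_ <-] := Dq k.
apply: near_eq_derive; near=> s; rewrite /w mulmxA mulmxV ?mul1mx //.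
by rewrite unitmxE unitfE; near: s; exact: near_det_neq0.
Unshelve. all: by end_near. Qed.

(** The velocity derivative [dw] is eliminated: [q = P(h)w] turns [q.dw] into [w.P(h)dw], where
    [P(h)dw = dq - P(dh)w] and [P(dh)w = P(w)dh]. *)
Lemma kinetic_is_derive :
  is_derive t 1 (fun s => dot (q s) (w s))
    (2 * dot (w t) dq - dot (Pm M (w t) *m w t) dh).
Proof.
have [dw Dw dwE] := velocity_is_vderive; have := is_derive_dot Dq Dw.
have qE : q t = Pm M (h t) *m w t by rewrite /w mulmxA mulmxV ?mul1mx.
have -> : dot dq (w t) + dot (q t) dw
    = 2 * dot (w t) dq - dot (Pm M (w t) *m w t) dh.
  rewrite qE !dot_Pml // -dwE (PmC symM dh) dotDr dotC dotDr.
  ring.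
by [].
Qed.

End Velocity.

(** Half of the terms [- P(w)w.dh] from the two kinetic derivatives forms the kinetic part of
    [energy_grad_h]. *)
Lemma energy_is_derive t (U : R -> st R K) (B : vec) (dU : st R K) :
  posdef (Pm M (hh (U t))) ->
  (forall c k, is_derive t 1 (fun s => stc (U s) c k) (stc dU c k)) ->
  is_derive t 1 (fun s => energy M g (U s) B) (energy_rate M g (U t) B dU).
Proof.
move=> /posdef_unitmx uh DU.
have Dh : is_vderive t (fun s => hh (U s)) (hh dU) := DU ord0.
have Dqx : is_vderive t (fun s => qqx (U s)) (qqx dU) :=
  DU (@Ordinal 3 1 isT).
have Dqy : is_vderive t (fun s => qqy (U s)) (qqy dU) :=
  DU (@Ordinal 3 2 isT).
have Du := kinetic_is_derive Dh Dqx uh; have Dv := kinetic_is_derive Dh Dqy uh.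
have Dhh := is_derive_dot Dh Dh.
have DB : is_vderive t (fun=> B) 0 by move=> k; rewrite mxE; exact: is_derive_cst.
have DhB := is_derive_dot Dh DB.
have cD c f df := is_derive_mul (is_derive_cst (c : R) t 1) (f2 := f) (d2 := df).
have := is_derive_add (is_derive_add (cD 2^-1 _ _ (is_derive_add Du Dv))
  (cD (g / 2) _ _ Dhh)) (cD g _ _ DhB).
rewrite /energy; under eq_fun do rewrite /cst.
rewrite [X in is_derive _ _ _ X -> _](_ : _ = energy_rate M g (U t) B dU).
  by apply: is_derive_eqfun => s; rewrite [in RHS]mxE.
rewrite /energy_rate /energy_grad_h -/(uof M (U t)) -/(vof M (U t)).
rewrite !(dotDl, dotNl, dotZl) (dotC (hh dU)) (dotC _ 0).
rewrite [dot 0 _](_ : _ = 0); last by rewrite -(scale0r 0) dotZl mul0r.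
by rewrite (dotC (hh dU)) /cst; field.
Qed.

End EnergyDerivative.

(** * Truncation error along one grid line *)

Section Truncation.
Variables (R : realType) (K : nat) (M : 'I_K.+1 -> 'M[R]_K.+1) (g : R).
Local Notation vec := 'cV[R]_K.+1.

(* With [phi s = F(U(0), U(s))] and [chi s = F(U(s), U(s))] for a symmetric
   two-point function [F], the chain rule gives [chi'(0) = 2 phi'(0)]; this
   relation is stable under sums and products. *)
Definition diag_pair (phi chi : R -> R) : Prop :=
  [/\ phi 0 = chi 0, Cn 3 phi &
      exists2 d : R, is_derive (0 : R) 1 phi d & is_derive (0 : R) 1 chi (2 * d)].

Lemma diag_pair_cst (c : R) : diag_pair (fun=> c) (fun=> c).
Proof.
split=> //; first exact: Cn_cst.
by exists 0; rewrite ?mulr0; exact: is_derive_cst.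
Qed.

Lemma diag_pair_add phi1 chi1 phi2 chi2 :
  diag_pair phi1 chi1 -> diag_pair phi2 chi2 ->
  diag_pair (fun s => phi1 s + phi2 s) (fun s => chi1 s + chi2 s).
Proof.
move=> [e1 c1 [d1 p1 q1]] [e2 c2 [d2 p2 q2]]; split; first by rewrite e1 e2.
  exact: Cn_add.
by exists (d1 + d2); rewrite ?mulrDr; exact: is_derive_add.
Qed.

(** The product rule evaluates the other factor at 0, which is why [diag_pair] records agreement of
    values there. *)
Lemma diag_pair_mul phi1 chi1 phi2 chi2 :
  diag_pair phi1 chi1 -> diag_pair phi2 chi2 ->
  diag_pair (fun s => phi1 s * phi2 s) (fun s => chi1 s * chi2 s).
Proof.
move=> [e1 c1 [d1 p1 q1]] [e2 c2 [d2 p2 q2]]; split; first by rewrite e1 e2.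
  exact: Cn_mul.
exists (d1 * phi2 0 + phi1 0 * d2); first exact: is_derive_mul.
have -> : 2 * (d1 * phi2 0 + phi1 0 * d2) = 2 * d1 * chi2 0 + chi1 0 * (2 * d2).
  by rewrite e1 e2; ring.
exact: is_derive_mul.
Qed.

Lemma diag_pair_sum (I : Type) (r : seq I) (phi chi : I -> R -> R) :
  (forall i, diag_pair (phi i) (chi i)) ->
  diag_pair (fun s => \sum_(i <- r) phi i s) (fun s => \sum_(i <- r) chi i s).
Proof.
move=> h; elim: r => [|i r IH].
  under eq_fun do rewrite big_nil; under [X in diag_pair _ X]eq_fun do rewrite big_nil.
  exact: diag_pair_cst.
under eq_fun do rewrite big_cons; under [X in diag_pair _ X]eq_fun do rewrite big_cons.
exact: diag_pair_add.
Qed.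

Definition diag_vpair (a b : R -> vec) : Prop :=
  forall k, diag_pair (fun s => a s k 0) (fun s => b s k 0).

Lemma diag_vpair_add a1 b1 a2 b2 : diag_vpair a1 b1 -> diag_vpair a2 b2 ->
  diag_vpair (fun s => a1 s + a2 s) (fun s => b1 s + b2 s).
Proof.
move=> h1 h2 k; under eq_fun do rewrite mxE.
by under [X in diag_pair _ X]eq_fun do rewrite mxE; exact: diag_pair_add.
Qed.

Lemma diag_vpair_scale (c : R) a b : diag_vpair a b ->
  diag_vpair (fun s => c *: a s) (fun s => c *: b s).
Proof.
move=> h k; under eq_fun do rewrite mxE.
under [X in diag_pair _ X]eq_fun do rewrite mxE.
by apply: diag_pair_mul => //; exact: diag_pair_cst.
Qed.

Lemma diag_vpair_Pm a1 b1 a2 b2 : diag_vpair a1 b1 -> diag_vpair a2 b2 ->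
  diag_vpair (fun s => Pm M (a1 s) *m a2 s) (fun s => Pm M (b1 s) *m b2 s).
Proof.
move=> h1 h2 k; under eq_fun do rewrite PmE.
under [X in diag_pair _ X]eq_fun do rewrite PmE.
apply: diag_pair_sum => j; apply: diag_pair_sum => i.
by do !apply: diag_pair_mul => //; exact: diag_pair_cst.
Qed.

Definition vCn n (a : R -> vec) : Prop := forall k, Cn n (fun s => a s k 0).

(** Source of the factor 2: freezing one argument of the average halves its derivative. *)
Lemma diag_vpair_avg a : vCn 3 a ->
  diag_vpair (fun s => avg (a 0) (a s)) (fun s => avg (a s) (a s)).
Proof.
move=> Ca k; have [a' Da _] := Ca k.
have avgE s : avg (a 0) (a s) k 0 = 2^-1 * (a 0 k 0 + a s k 0) by rewrite !mxE.
under eq_fun do rewrite avgE; under [X in diag_pair _ X]eq_fun do rewrite avg_same.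
split.
- lra.
- by apply: Cn_mul; [exact: Cn_cst|apply: Cn_add => //; exact: Cn_cst].
exists (2^-1 * a' 0); last by rewrite mulrA divff // mul1r.
have := is_derive_mul (is_derive_cst (2^-1 : R) (0 : R) 1)
  (is_derive_add (is_derive_cst (a 0 k 0) (0 : R) 1) (Da 0)).
by rewrite mul0r !add0r.
Qed.

Lemma vCn_Pm n a b : vCn n a -> vCn n b -> vCn n (fun s => Pm M (a s) *m b s).
Proof.
move=> Ca Cb k; apply: (fct_algebra_mulmx (Cn_fct_algebra R n)) => i j.
  exact: (fct_algebra_Pm (Cn_fct_algebra R n)).
by rewrite ord1.
Qed.

Lemma vCn_velocity n h q : (forall s, posdef (Pm M (h s))) ->
  vCn n h -> vCn n q -> vCn n (fun s => invmx (Pm M (h s)) *m q s).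
Proof.
move=> ph Ch Cq k; have CP := fct_algebra_Pm (Cn_fct_algebra R n) M Ch.
have d0 s : \det (Pm M (h s)) != 0.
  by rewrite -unitfE -unitmxE; exact: posdef_unitmx.
under eq_fun do rewrite invmxE //.
apply: (fct_algebra_cramer (Cn_fct_algebra R n)) => //.
by apply: Cn_inv => //; exact: (fct_algebra_det (Cn_fct_algebra R n)).
Qed.

Hypothesis symM : sym_tensor M.

Lemma FEC_sym UL UR : FEC M g UL UR = FEC M g UR UL.
Proof.
by rewrite /FEC (avgC (hh UL)) (avgC (uof M UL)) (avgC (vof M UL))
  (avgC (Pm M (hh UL) *m hh UL)).
Qed.

(** As [P(h)u] is the discharge [q], the advective terms agree through [P(u)q = P(q)u] and its
    analogue for [v]. *)
Lemma FEC_consistent U : Pm M (hh U) \in unitmx -> FEC M g U U = Fhat M g U.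
Proof.
move=> uh; rewrite /FEC /Fhat !avg_same.
have -> : Pm M (hh U) *m uof M U = qqx U by rewrite /uof mulmxA mulmxV ?mul1mx.
rewrite (PmC symM (uof M U)) (PmC symM (vof M U)) addrC.
by rewrite -/(uof M U) -/(vof M U).
Qed.

(** The whole x part of [rhs], bottom source included; conjugating by [swapq] gives the y part. *)
Definition flux_difference (dx : R) (Um U0 Up : st R K) (Bm B0 Bp : vec) : st R K :=
  let Fp := FEC M g U0 Up in
  let Fm := FEC M g Um U0 in
  St (- dx^-1 *: (hh Fp - hh Fm))
     (- dx^-1 *: (qqx Fp - qqx Fm)
      + - (g / (2 * dx)) *: (Pm M (avg (hh U0) (hh Up)) *m (Bp - B0)
                             + Pm M (avg (hh Um) (hh U0)) *m (B0 - Bm)))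
     (- dx^-1 *: (qqy Fp - qqy Fm)).

Lemma rhs_split dx dy U B i j c k :
  stc (rhs M g dx dy U B i j) c k =
  stc (flux_difference dx (U (i - 1) j) (U i j) (U (i + 1) j)
         (B (i - 1) j) (B i j) (B (i + 1) j)) c k
  + stc (swapq (flux_difference dy
           (swapq (U i (j - 1))) (swapq (U i j)) (swapq (U i (j + 1)))
           (B i (j - 1)) (B i j) (B i (j + 1)))) c k.
Proof.
(* The source [s] belongs to the x part in the second component and to the y part in the third,
   hence two regroupings. *)
have E (a b s : vec) : (a + b + s) k 0 = (a + s) k 0 + b k 0.
  by rewrite !mxE addrAC.
have E' (a b s : vec) : (a + b + s) k 0 = a k 0 + (b + s) k 0.
  by rewrite !mxE addrA.
rewrite /rhs /stc; case: ifP => _ /=; first by rewrite mxE -scaleNr.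
by case: ifP => _ /=; rewrite -scaleNr; [exact: E|exact: E'].
Qed.

Section OneDimensional.
Variables (U : R -> st R K) (B : R -> vec) (dB : vec).
Hypothesis CU : forall c k, Cn 3 (fun s => stc (U s) c k).
Hypothesis CB : vCn 3 B.
Hypothesis DB : is_vderive 0 B dB.
Hypothesis pU : forall s, posdef (Pm M (hh (U s))).

Let Ch : vCn 3 (fun s => hh (U s)) := CU ord0.
Let Cqx : vCn 3 (fun s => qqx (U s)) := CU (@Ordinal 3 1 isT).
Let Cqy : vCn 3 (fun s => qqy (U s)) := CU (@Ordinal 3 2 isT).

Lemma FEC_diag_pair c k :
  diag_pair (fun s => stc (FEC M g (U 0) (U s)) c k)
            (fun s => stc (FEC M g (U s) (U s)) c k).
Proof.
have ph := diag_vpair_avg Ch.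
have pu := diag_vpair_avg (vCn_velocity pU Ch Cqx).
have pv := diag_vpair_avg (vCn_velocity pU Ch Cqy).
have pp := diag_vpair_avg (vCn_Pm Ch Ch).
have pw := diag_vpair_Pm ph pu.
rewrite /stc /FEC /=; case: (val c == 0%N); first exact: pw.
case: (val c == 1%N); last exact: diag_vpair_Pm pv pw k.
exact: diag_vpair_add (diag_vpair_scale (g / 2) pp) (diag_vpair_Pm pu pw) k.
Qed.

Let source s : vec := Pm M (avg (hh (U 0)) (hh (U s))) *m (B s - B 0).

Lemma source_Cn : vCn 3 source.
Proof.
apply: vCn_Pm => k; first by have [] := diag_vpair_avg Ch k.
under eq_fun do rewrite 2!mxE; apply: Cn_add; first exact: CB.
exact: Cn_cst.
Qed.

(** The factor [B s - B 0] vanishes at 0, so the derivative of the averaged height drops out. *)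
Lemma source_is_vderive : is_vderive 0 source (Pm M (hh (U 0)) *m dB).
Proof.
have [/= dh Dh] : exists dh, is_vderive 0 (fun s => avg (hh (U 0)) (hh (U s))) dh.
  exists (\col_k 'D_1 (fun s => avg (hh (U 0)) (hh (U s)) k 0) (0 : R)) => k.
  have [_ _ [d [Dd _] _]] := diag_vpair_avg Ch k.
  by rewrite mxE; exact: derivableP.
have DB0 : is_vderive 0 (fun s => B s - B 0) dB.
  move=> k; have := is_derive_add (DB k) (is_derive_cst (- B 0 k 0) (0 : R) 1).
  by rewrite addr0; apply: is_derive_eqfun => s; rewrite !mxE.
have := is_vderive_Pm M Dh DB0.
by rewrite subrr mulmx0 add0r avg_same.
Qed.

Lemma flux_difference_truncation c k :
  exists C delta : R, 0 < delta /\ forall s, 0 < s < delta ->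
    `|stc (flux_difference s (U (- s)) (U 0) (U s) (B (- s)) (B 0) (B s)) c k
      - (- 'D_1 (fun s => stc (Fhat M g (U s)) c k) (0 : R)
         + stc (Shat M g (U 0) dB 0) c k)| <= C * s ^+ 2.
Proof.
have [_ CF [d DF DF2]] := FEC_diag_pair c k.
(* With the factor [g / 2], the discrete source is [- (S s - S (- s)) / s], and [2 * dS] is the
   exact source up to sign. *)
pose S s := if val c == 1%N then g / 2 * source s k 0 else 0.
pose dS := if val c == 1%N then g / 2 * (Pm M (hh (U 0)) *m dB) k 0 else 0.
have CS : Cn 3 S.
  rewrite /S; case: (val c == 1%N); last exact: Cn_cst.
  by apply: Cn_mul; [exact: Cn_cst|exact: source_Cn].
have DS : is_derive (0 : R) 1 S dS.
  rewrite /S /dS; case: (val c == 1%N); last exact: is_derive_cst.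
  have := is_derive_mul (is_derive_cst (g / 2) (0 : R) 1) (source_is_vderive k).
  by rewrite mul0r add0r.
have [C [delta [delta0 bnd]]] :=
  central_difference (Cn_add CF CS) (is_derive_add DF DS).
exists C, delta; split=> // s /[dup] sd /bnd; rewrite -normrN.
congr (`|_| <= _).
have FE : (fun s => stc (FEC M g (U s) (U s)) c k)
        = (fun s => stc (Fhat M g (U s)) c k).
  by apply/funext => t; rewrite FEC_consistent //; exact: posdef_unitmx.
rewrite FE in DF2; have [_ ->] := DF2.
(* Symmetry rewrites the left interface as the right one taken at [- s], with the bottom jump
   changing sign. *)
rewrite /flux_difference (FEC_sym (U (- s))) (avgC (hh (U (- s)))).
rewrite -[B 0 - B (- s)]opprB mulmxN /Shat /S /dS -/(source s) -/(source (- s)).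
have zE (z : R) (a : vec) : (z *: a) k 0 = z * a k 0 by rewrite mxE.
have aE (a b : vec) : (a + b) k 0 = a k 0 + b k 0 by rewrite mxE.
have nE (a : vec) : (- a) k 0 = - a k 0 by rewrite mxE.
have oE : (0 : vec) k 0 = 0 by rewrite mxE.
rewrite /stc !mulmx0 scaler0 /=; case: eqP => [->|_] /=.
  by rewrite !(zE, aE, nE, oE); ring.
case: ifP => _; rewrite !(zE, aE, nE, oE) ?invfM; last by ring.
field.
by case/andP: sd => /gt_eqF ->.
Qed.

End OneDimensional.

End Truncation.

(** * Restriction of smooth functions of the plane to lines *)

Section Slices.
Variable R : realType.
Implicit Types (f : (R * R)%type -> R) (p v : (R * R)%type).

(** Equality of the quotients as functions transfers both existence and value of the derivative. *)
Lemma slice_quotient f p v (s : R) :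
  (fun h : R => h^-1 *: (((fun t : R => f (p + t *: v)) \o shift s) (h *: 1)
                         - f (p + s *: v))) =
  (fun h : R => h^-1 *: ((f \o shift (p + s *: v)) (h *: v) - f (p + s *: v))).
Proof.
apply/funext => h /=; congr (_ *: (f _ - _)).
have -> : h *: (1 : R) = h by exact: mulr1.
by rewrite scalerDl addrCA.
Qed.

Lemma slice_is_derive f p v (s : R) : derivable f (p + s *: v) v ->
  is_derive s 1 (fun t : R => f (p + t *: v)) ('D_v f (p + s *: v)).
Proof.
move=> df; apply: DeriveDef; last by rewrite /derive slice_quotient.
by rewrite /derivable slice_quotient.
Qed.

Lemma slice_derive f p v (s : R) :
  'D_1 (fun t : R => f (p + t *: v)) s = 'D_v f (p + s *: v).
Proof. by rewrite /derive slice_quotient. Qed.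

(** The derivative of a slice is a slice of the directional derivative, which is again smooth
    because [iterpd] applies the head of its list first. *)
Lemma smooth2_slice n f p b : smooth2 f -> Cn n (fun s => f (p + s *: dir2 R b)).
Proof.
elim: n f => [|n IH] f sf.
  move=> s; apply: continuous_comp; last exact: (sf [::]).1.
  apply: cvgD; first exact: cvg_cst.
  by apply: cvgZr_tmp.
exists (fun s => 'D_(dir2 R b) f (p + s *: dir2 R b)).
  by move=> s; apply: slice_is_derive; exact: (sf [::]).2.
by apply: (IH ('D_(dir2 R b) f)) => ds; exact: (sf (b :: ds)).
Qed.

End Slices.

(** Finitely many bounds share the largest constant and the smallest threshold. *)
Lemma uniform_square_bound (R : realType) (I : finType) (F : I -> R -> R) :
  (forall i, exists C delta : R, 0 < delta /\
     forall s, 0 < s < delta -> `|F i s| <= C * s ^+ 2) ->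
  exists C delta : R, 0 < delta /\
    forall i s, 0 < s < delta -> `|F i s| <= C * s ^+ 2.
Proof.
move=> h; suff [C [delta [d0 H]]] : exists C delta : R, 0 < delta /\
    forall i s, i \in enum I -> 0 < s < delta -> `|F i s| <= C * s ^+ 2.
  by exists C, delta; split=> // i s; apply: H; rewrite mem_enum.
elim: (enum I) => [|j r [C [e [e0 H]]]]; first by exists 0, 1.
have [C' [e' [e'0 H']]] := h j.
exists (Num.max C' C), (Num.min e' e); split; first by rewrite lt_min e0 e'0.
move=> i s; rewrite inE lt_min => ir /and3P[s0 se' se].
have s2 : 0 <= s ^+ 2 by rewrite sqr_ge0.
case/predU1P: ir => [->|/H {}H].
  by rewrite (le_trans (H' s _)) ?s0 // ler_wpM2r // le_max lexx.
by rewrite (le_trans (H s _)) ?s0 // ler_wpM2r // le_max lexx orbT.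
Qed.

Lemma Mtrip_sym (R : realType) (d : measure_display) (T : measurableType d)
    (mu : probability T R) (K : nat) (phi : 'I_K.+1 -> T -> R) :
  sym_tensor (Mtrip mu phi).
Proof.
split=> k l m; rewrite !mxE; apply: eq_Rintegral => x _.
  by rewrite [phi k x * _]mulrC.
by rewrite mulrAC.
Qed.

(** * Truncation errors in the two coordinate directions *)

Section TwoDimensional.
Variables (R : realType) (K : nat) (M : 'I_K.+1 -> 'M[R]_K.+1) (g : R).
Local Notation vec := 'cV[R]_K.+1.
Hypothesis symM : sym_tensor M.

(** The index [c'] is chosen before [U] and [k], so it can be substituted inside functions of the
    point. *)
Lemma stc_swapq c : exists c', forall (U : st R K) k, stc (swapq U) c k = stc U c' k.
Proof.
case: c => [[|[|[|//]]] lc].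
- by exists ord0.
- by exists (@Ordinal 3 2 isT).
- by exists (@Ordinal 3 1 isT).
Qed.

Variables (U : (R * R)%type -> st R K) (B : (R * R)%type -> vec).
Hypothesis sU : forall c k, smooth2 (fun p => stc (U p) c k).
Hypothesis sB : forall k, smooth2 (fun p => B p k 0).
Hypothesis pU : forall p, posdef (Pm M (hh (U p))).

Let dB b p : vec := \col_k 'D_(dir2 R b) (fun q => B q k 0) p.

Let slice_B_is_vderive b p :
  is_vderive 0 (fun s => B (p + s *: dir2 R b)) (dB b p).
Proof.
move=> k; rewrite mxE -{2}[p]addr0 -(scale0r (dir2 R b)).
by apply: slice_is_derive; exact: ((sB k) [::]).2.
Qed.

Lemma truncation_x p c k :
  exists C delta : R, 0 < delta /\ forall s, 0 < s < delta ->
    `|stc (flux_difference M g s (U (p + (- s) *: dir2 R true)) (U p)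
             (U (p + s *: dir2 R true)) (B (p + (- s) *: dir2 R true)) (B p)
             (B (p + s *: dir2 R true))) c k
      - (- 'D_(dir2 R true) (fun q => stc (Fhat M g (U q)) c k) p
         + stc (Shat M g (U p) (dB true p) 0) c k)| <= C * s ^+ 2.
Proof.
have := @flux_difference_truncation R K M g symM
  (fun s => U (p + s *: dir2 R true)) (fun s => B (p + s *: dir2 R true))
  (dB true p) (fun c k => smooth2_slice 3 p true (sU c k))
  (fun k => smooth2_slice 3 p true (sB k)) (slice_B_is_vderive true p)
  (fun s => pU _) c k.
by rewrite (slice_derive (fun q => stc (Fhat M g (U q)) c k)) !scale0r !addr0.
Qed.

(** The one-line estimate is applied to the states with exchanged discharges, [Ghat] being [Fhat]
    conjugated by [swapq]. *)
Lemma truncation_y p c k :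
  exists C delta : R, 0 < delta /\ forall s, 0 < s < delta ->
    `|stc (swapq (flux_difference M g s (swapq (U (p + (- s) *: dir2 R false)))
             (swapq (U p)) (swapq (U (p + s *: dir2 R false)))
             (B (p + (- s) *: dir2 R false)) (B p)
             (B (p + s *: dir2 R false)))) c k
      - (- 'D_(dir2 R false) (fun q => stc (Ghat M g (U q)) c k) p
         + stc (Shat M g (U p) 0 (dB false p)) c k)| <= C * s ^+ 2.
Proof.
have sU' c' k' : smooth2 (fun p => stc (swapq (U p)) c' k').
  have [c'' E] := stc_swapq c'.
  by rewrite (_ : (fun _ => _) = fun p => stc (U p) c'' k'); last exact/funext.
have [c' E] := stc_swapq c.
have := @flux_difference_truncation R K M g symM
  (fun s => swapq (U (p + s *: dir2 R false))) (fun s => B (p + s *: dir2 R false))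
  (dB false p) (fun c k => smooth2_slice 3 p false (sU' c k))
  (fun k => smooth2_slice 3 p false (sB k)) (slice_B_is_vderive false p)
  (fun s => pU _) c' k.
rewrite (slice_derive (fun q => stc (Fhat M g (swapq (U q))) c' k)).
rewrite !scale0r !addr0 -E.
have -> : (fun q => stc (Fhat M g (swapq (U q))) c' k) =
    (fun q => stc (Ghat M g (U q)) c k) by apply/funext => q; rewrite -E.
move=> [C [delta [delta0 H]]]; exists C, delta; split=> // s /H.
by rewrite -E.
Qed.

End TwoDimensional.

Theorem theorem4p1 (R : realType) (d : measure_display) (T : measurableType d)
  (mu : probability T R) (K : nat) (phi : 'I_K.+1 -> T -> R) (g : R) :
  sg_basis mu phi -> 0 < g ->
  let M := Mtrip mu phi in
  (* (1) well-balanced *)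
  (forall (dx dy : R) (U : int -> int -> st R K) (B : int -> int -> 'cV[R]_K.+1),
     0 < dx -> 0 < dy ->
     (forall i j, posdef (Pm M (hh (U i j)))) ->
     (forall i j, qqx (U i j) = 0 /\ qqy (U i j) = 0) ->
     (exists C : 'cV[R]_K.+1, forall i j, hh (U i j) + B i j = C) ->
     forall i j, rhs M g dx dy U B i j = St 0 0 0)
  /\
  (* (2) energy conservative: there are two-point numerical energy fluxes *)
  (exists (Hf Kf : st R K -> 'cV[R]_K.+1 -> st R K -> 'cV[R]_K.+1 -> R),
   forall (dx dy : R) (B : int -> int -> 'cV[R]_K.+1)
          (U : R -> int -> int -> st R K) (t : R),
     0 < dx -> 0 < dy ->
     (forall i j, posdef (Pm M (hh (U t i j)))) ->
     (forall i j c k, is_derive t 1 (fun s => stc (U s i j) c k)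
                        (stc (rhs M g dx dy (U t) B i j) c k)) ->
     forall i j,
       is_derive t 1 (fun s => energy M g (U s i j) (B i j))
         (- (Hf (U t i j) (B i j) (U t (i + 1)%R j) (B (i + 1)%R j)
             - Hf (U t (i - 1)%R j) (B (i - 1)%R j) (U t i j) (B i j)) / dx
          - (Kf (U t i j) (B i j) (U t i (j + 1)%R) (B i (j + 1)%R)
             - Kf (U t i (j - 1)%R) (B i (j - 1)%R) (U t i j) (B i j)) / dy))
  /\
  (* (3) local truncation error O(dx^2 + dy^2) *)
  (forall (Uh : (R * R)%type -> st R K) (Bh : (R * R)%type -> 'cV[R]_K.+1),
     (forall c k, smooth2 (fun p => stc (Uh p) c k)) ->
     (forall k, smooth2 (fun p => Bh p k 0)) ->
     (forall p, posdef (Pm M (hh (Uh p)))) ->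
     forall x0 y0 : R,
     let Bx := \col_k 'D_(dir2 R true) (fun p => Bh p k 0) (x0, y0) in
     let By := \col_k 'D_(dir2 R false) (fun p => Bh p k 0) (x0, y0) in
     exists C delta : R, 0 < delta /\
       forall dx dy : R, 0 < dx < delta -> 0 < dy < delta ->
       forall c k,
         `| stc (rhs M g dx dy
                   (fun i j => Uh (x0 + i%:~R * dx, y0 + j%:~R * dy))
                   (fun i j => Bh (x0 + i%:~R * dx, y0 + j%:~R * dy)) 0 0) c k
            - (- 'D_(dir2 R true) (fun p => stc (Fhat M g (Uh p)) c k) (x0, y0)
               - 'D_(dir2 R false) (fun p => stc (Ghat M g (Uh p)) c k) (x0, y0)
               + stc (Shat M g (Uh (x0, y0)) Bx By) c k) |
         <= C * (dx ^+ 2 + dy ^+ 2)).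
Proof.
move=> _ _ M; have symM : sym_tensor M := Mtrip_sym mu phi.
split; [|split].
- by move=> dx dy U B _ _ _; exact: rhs_lake_at_rest.
- exists (eflux M g), (eflux_y M g) => dx dy B U t _ _ pU DU i j.
  rewrite -energy_rate_rhs //.
  exact: energy_is_derive (pU i j) (DU i j).
move=> Uh Bh sU sB pU x0 y0 Bx By.
(* Pairs of component and basis index form a finite type, so one constant serves them all. *)
have [Cx [ex [ex0 Hx]]] := uniform_square_bound
  (fun ck : 'I_3 * 'I_K.+1 =>
     truncation_x g symM sU sB pU (x0, y0) ck.1 ck.2).
have [Cy [ey [ey0 Hy]]] := uniform_square_bound
  (fun ck : 'I_3 * 'I_K.+1 =>
     truncation_y g symM sU sB pU (x0, y0) ck.1 ck.2).
exists (Num.max Cx Cy), (Num.min ex ey); split; first by rewrite lt_min ex0.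
move=> dx dy; rewrite !lt_min => /and3P[dx0 dxe _] /and3P[dy0 _ dye] c k.
have {}Hx := Hx (c, k) dx; have {}Hy := Hy (c, k) dy.
rewrite dx0 dxe in Hx; rewrite dy0 dye in Hy.
have {Hx}/= Hx := Hx isT; have {Hy}/= Hy := Hy isT.
have px (n : int) : (x0 + n%:~R * dx, y0 + 0%:~R * dy) =
    (x0, y0) + (n%:~R * dx) *: dir2 R true.
  by congr pair; rewrite /= /GRing.scale /= ?mulr1 ?mulr0 ?mul0r.
have py (n : int) : (x0 + 0%:~R * dx, y0 + n%:~R * dy) =
    (x0, y0) + (n%:~R * dy) *: dir2 R false.
  by congr pair; rewrite /= /GRing.scale /= ?mulr1 ?mulr0 ?mul0r.
have p0 : (x0 + 0%:~R * dx, y0 + 0%:~R * dy) = (x0, y0).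
  by rewrite px mul0r scale0r addr0.
rewrite rhs_split !add0r p0 !px !py !mulrN1z !mulr1z !mulN1r !mul1r.
(* Each bottom slope enters a single component, so the exact source splits between the two
   directional estimates. *)
have ShatE : stc (Shat M g (Uh (x0, y0)) Bx By) c k =
    stc (Shat M g (Uh (x0, y0)) Bx 0) c k + stc (Shat M g (Uh (x0, y0)) 0 By) c k.
  have z0 : (0 : 'cV[R]_K.+1) k 0 = 0 by rewrite mxE.
  rewrite /Shat !mulmx0 scaler0 /stc.
  by do 2?[case: ifP => _ /=]; rewrite z0 ?addr0 ?add0r.
rewrite ShatE.
rewrite (mulrDr (Num.max Cx Cy)).
apply: le_trans (lerD (le_trans Hx _) (le_trans Hy _)).
- apply: le_trans (ler_normD _ _); rewrite le_eqVlt; apply/orP; left.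
  by apply/eqP; congr `|_|; ring.
- by rewrite ler_wpM2r ?sqr_ge0 // le_max lexx.
- by rewrite ler_wpM2r ?sqr_ge0 // le_max lexx orbT.
Qed.
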